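(* For any constants $c\in(0,1)$ and $\epsilon>0$, there is no $(1-c+\epsilon)$-approximation algorithm using polynomially many value queries for the problem $\max\{f(S):|S|\le k\}$, where $f:2^X\to\mathbb{R}_{\ge0}$ is a monotone nondecreasing function of curvature $c$.
   Context: $f_A(j)=f(A\cup\{j\})-f(A)$. The (generalized) curvature of a monotone function is $c=1-\min_{j\in X}\min_{S,T\subseteq X\setminus\{j\}}\frac{f_S(j)}{f_T(j)}$. The function is accessed only through a value oracle returning $f(Q)$ for queried sets $Q$. An $\alpha$-approximation returns $S$ with $|S|\le k$ and $f(S)\ge\alpha\max_{|T|\le k}f(T)$. *)

(* Defs.v *)
From mathcomp Require Import all_boot all_order all_algebra.
From mathcomp Require Import reals.

Set Implicit Arguments.
Unset Strict Implicit.
Unset Printing Implicit Defensive.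

Import Order.TTheory GRing.Theory Num.Theory.
Local Open Scope ring_scope.

Definition marginal (R : realType) (X : finType) (f : {set X} -> R)
  (A : {set X}) (j : X) : R := f (j |: A) - f A.

Definition monotone (R : realType) (X : finType) (f : {set X} -> R) : Prop :=
  forall A B : {set X}, A \subset B -> f A <= f B.

(* The minimum is over the ratios whose denominator is nonzero (in MathComp
   x / 0 = 0, which would otherwise make the curvature 1 as soon as one
   marginal vanishes).  Using 1 as the default value does not alter the minimum:
   the ratio 1 is attained at S = T whenever some marginal is nonzero, and a
   constant function gets curvature 0. *)
Definition curvature (R : realType) (X : finType) (f : {set X} -> R) : R :=
  1 - \big[Num.min/1]_(j : X)
        \big[Num.min/1]_(S : {set X} | S \subset [set~ j])
          \big[Num.min/1]_(T : {set X} |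
                             (T \subset [set~ j]) && (marginal f T j != 0))
            (marginal f S j / marginal f T j).

(* The default value f set0 is itself attained, set0 being feasible. *)
Definition opt (R : realType) (X : finType) (f : {set X} -> R) (k : nat) : R :=
  \big[Num.max/f set0]_(T : {set X} | (#|T| <= k)%N) f T.

(* Randomized adaptive algorithms with access to f only through a value oracle:
   [Query Q next] asks for f Q and continues with [next (f Q)]; [Draw m next]
   draws i uniformly from {0, ..., m} and continues with [next i].  A
   deterministic algorithm is one without [Draw] nodes.  Computation between
   queries is unrestricted. *)
Inductive oracle_alg (R : Type) (X : finType) : Type :=
| Output of {set X}
| Query of {set X} & (R -> oracle_alg R X)
| Draw (m : nat) of ('I_m.+1 -> oracle_alg R X).

(* Worst case over the random draws. *)
Fixpoint num_queries (R : Type) (X : finType) (f : {set X} -> R)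
    (A : oracle_alg R X) : nat :=
  match A with
  | Output _ => 0%N
  | Query Q next => (num_queries f (next (f Q))).+1
  | Draw m next => (\max_(i < m.+1) num_queries f (next i))%N
  end.

Fixpoint output_prob (R : realType) (X : finType) (f : {set X} -> R)
    (E : pred {set X}) (A : oracle_alg R X) : R :=
  match A with
  | Output Z => (E Z)%:R
  | Query Q next => output_prob f E (next (f Q))
  | Draw m next => (\sum_(i < m.+1) output_prob f E (next i)) / m.+1%:R
  end.

(* The ground set of size n is taken to be {0, ..., n-1}. *)
Definition admissible (R : realType) (c : R) (n : nat)
    (f : {set 'I_n} -> R) : Prop :=
  [/\ forall S, 0 <= f S, monotone f & curvature f = c].

(* An algorithm receives the size n of the ground set and the bound k. *)
Definition alg_family (R : realType) : Type :=
  forall n : nat, nat -> oracle_alg R 'I_n.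

Definition polynomially_many_queries (R : realType) (c : R)
    (A : alg_family R) : Prop :=
  exists q : {poly nat}, forall (n k : nat) (f : {set 'I_n} -> R),
    admissible c f -> (num_queries f (A n k) <= q.[n])%N.

Definition approx_solution (R : realType) (alpha : R) (X : finType)
    (f : {set X} -> R) (k : nat) : pred {set X} :=
  fun S => (#|S| <= k)%N && (alpha * opt f k <= f S).

(* Success is required only with some probability p > 0 not depending on the
   instance.  A deterministic alpha-approximation has p = 1.  If the output is
   always feasible and is an alpha-approximation in expectation, then for
   0 < d < alpha it is an (alpha - d)-approximation in this sense, with p = d. *)
Definition approximation_algorithm (R : realType) (c alpha : R)
    (A : alg_family R) : Prop :=
  exists2 p : R, 0 < p &
    forall (n k : nat) (f : {set 'I_n} -> R),
      admissible c f -> p <= output_prob f (approx_solution alpha f k) (A n k).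

(* Main.v *)
(* Hide a uniformly random k-subset O of an n-set behind
     f_O(S) = (1 - c) |S| + c max(|S :&: O| - a, |S| - k, 0),
   whose marginals range over [1 - c, 1] with both ends attained, so that its
   curvature is c. If |S :&: O| <= a or |S| >= 2k, then f_O(S) does not depend
   on O; a fixed S violates both with probability at most (2 k^2 / n)^(a + 1).
   Without such a detection a feasible set is worth (1 - c) k at most, whereas
   f_O(O) >= k - c a. Take n = 2 k^3 and a constant a larger than three times
   the degree of the query bound, and let k grow. *)

Require Import Defs.
From mathcomp Require Import all_boot all_order all_algebra.
From mathcomp Require Import reals.
From mathcomp Require Import zify ring lra.

Import Order.TTheory GRing.Theory Num.Theory.
Local Open Scope ring_scope.

(** * Randomized computations compared with a reference oracle *)

Lemma output_prob_itv (R : realType) (X : finType) (f : {set X} -> R)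
    (E : pred {set X}) (A : oracle_alg R X) :
  0 <= output_prob f E A <= 1.
Proof.
elim: A => [Z|Q next IH|m next IH] //=; first by rewrite ler0n lern1 leq_b1.
apply/andP; split.
  by apply: divr_ge0 => //; apply: sumr_ge0 => i _; case/andP: (IH i).
rewrite ler_pdivrMr ?ltr0Sn // mul1r -[in leRHS](card_ord m.+1) -sum1_card natr_sum.
by apply: ler_sum => i _; case/andP: (IH i).
Qed.

(* As long as the oracle answers like [g], the computation does not depend on
   the instance [i], and each query (as well as the output) singles out at most
   [b] instances. *)
Lemma sum_output_prob_le (R : realType) (X I : finType)
    (f : I -> {set X} -> R) (g : {set X} -> R) (E : I -> pred {set X})
    (b : nat) (A : oracle_alg R X) (F : {set I}) :
  (forall S, #|[set i in F | f i S != g S]| <= b)%N ->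
  (forall S, #|[set i in F | E i S]| <= b)%N ->
  \sum_(i in F) output_prob (f i) (E i) A <= (b * (num_queries g A).+1)%:R.
Proof.
elim: A F => [Z|Q next IH|m next IH] F neq_le acc_le /=.
- rewrite muln1; apply: le_trans (_ : #|[set i in F | E i Z]|%:R <= _).
    rewrite -natr_sum ler_nat -sum1_card big_mkcond [leqRHS]big_mkcond /=.
    by apply: leq_sum => i _; rewrite inE; case: (i \in F); case: (E i Z).
  by rewrite ler_nat.
(* At most [b] instances answer [Q] differently from [g], each contributing at most 1; the others
   all continue with [next (g Q)], so induction applies to that subset of [F]. *)
- rewrite (bigID (fun i => f i Q != g Q)) /= mulnS natrD.
  apply: lerD.
    apply: le_trans (_ : #|[set i in F | f i Q != g Q]|%:R <= _); last first.
      by rewrite ler_nat.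
    rewrite -sum1_card natr_sum.
    rewrite [leRHS](eq_bigl (fun i => (i \in F) && (f i Q != g Q))); last first.
      by move=> i; rewrite inE.
    apply: ler_sum => i _.
    by case/andP: (output_prob_itv R X (f i) (E i) (next (f i Q))).
  rewrite (eq_big (fun i => i \in [set i in F | f i Q == g Q])
    (fun i => output_prob (f i) (E i) (next (g Q)))).
  + apply: IH => S.
      apply: leq_trans (neq_le S); apply/subset_leq_card/subsetP => i.
      by rewrite !inE => /andP[/andP[-> _] ->].
    apply: leq_trans (acc_le S); apply/subset_leq_card/subsetP => i.
    by rewrite !inE => /andP[/andP[-> _] ->].
  + by move=> i; rewrite inE negbK.
  + by move=> i /andP[_]; rewrite negbK => /eqP ->.
- rewrite -mulr_suml exchange_big /= ler_pdivrMr ?ltr0Sn //.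
  rewrite mulr_natr -[X in _ *+ X](card_ord m.+1) -sumr_const.
  apply: ler_sum => i _; apply: le_trans (IH i F neq_le acc_le) _.
  by rewrite ler_nat leq_mul2l ltnS (leq_bigmax i) orbT.
Qed.

(** * Counting [k]-sets with a large trace on a given set *)

Lemma bin_leq_expn (n t : nat) : ('C(n, t) <= n ^ t)%N.
Proof.
elim: t => [|t IH]; first by rewrite bin0.
have := mul_bin_left n t; rewrite expnS; nia.
Qed.

(** The quotient of the two binomials is the product over [i < t] of [(k - i) / (n - i)], each
    factor being at most [k / n]. *)
Lemma bin_sub_expn (n k t : nat) : (t <= k <= n)%N ->
  ('C(n - t, k - t) * n ^ t <= k ^ t * 'C(n, k))%N.
Proof.
elim: t => [|t IH] /andP[tk kn]; first by rewrite !subn0 muln1 mul1n.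
have {}IH := IH (introT andP (conj (ltnW tk) kn)).
have E : ((n - t) * 'C(n - t.+1, k - t.+1) = (k - t) * 'C(n - t, k - t))%N.
  have := mul_bin_diag (n - t) (k - t.+1).
  by rewrite -subnS subnSK.
have step : ('C(n - t.+1, k - t.+1) * n <= k * 'C(n - t, k - t))%N.
  have nt0 : (0 < n - t)%N by lia.
  rewrite -(leq_pmul2l nt0) mulnA E.
  have : ((k - t) * n <= k * (n - t))%N by nia.
  nia.
rewrite !expnS mulnA (leq_trans (leq_mul step (leqnn _))) //.
by rewrite -!mulnA leq_mul2l IH orbT.
Qed.

(** Removing [T] is injective on the supersets of [T]. *)
Lemma card_supersets (X : finType) (T : {set X}) (k : nat) : (#|T| <= k)%N ->
  (#|[set O : {set X} | (#|O| == k) && (T \subset O)]| <=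
    'C(#|X| - #|T|, k - #|T|))%N.
Proof.
move=> Tk; rewrite -cardsT -cardsDS ?subsetT // setTD -cards_draws.
rewrite -(card_in_imset (f := fun O => O :\: T)).
  apply/subset_leq_card/subsetP => _ /imsetP[O + ->].
  rewrite inE => /andP[/eqP Ok TO].
  by rewrite inE cardsDS // Ok eqxx setDE subsetIr.
move=> O1 O2; rewrite !inE => /andP[_ T1] /andP[_ T2] eqD.
by rewrite -(setID O1 T) -(setID O2 T) eqD (setIidPr T1) (setIidPr T2).
Qed.

(** Union bound: such an [O] contains some [t]-subset of [S]. *)
Lemma card_large_intersection (X : finType) (S : {set X}) (k t : nat) :
  (t <= k)%N ->
  (#|[set O : {set X} | (#|O| == k) && (t <= #|S :&: O|)%N]| <=
    'C(#|S|, t) * 'C(#|X| - t, k - t))%N.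
Proof.
move=> tk; set D := [set T : {set X} | (T \subset S) && (#|T| == t)].
apply: leq_trans (_ : \sum_(T in D)
    #|[set O : {set X} | (#|O| == k) && (T \subset O)]| <= _)%N.
  apply: leq_trans (_ : #|\bigcup_(T in D)
    [set O : {set X} | (#|O| == k) && (T \subset O)]| <= _)%N.
    apply/subset_leq_card/subsetP => O; rewrite inE => /andP[Ok tSO].
    have : (0 < #|[set T : {set X} | (T \subset S :&: O) && (#|T| == t)]|)%N.
      by rewrite cards_draws bin_gt0.
    case/card_gt0P => T; rewrite inE subsetI => /andP[/andP[TS TO] Tt].
    by apply/bigcupP; exists T; rewrite inE ?TS ?Ok.
  elim/big_rec2: _ => [|T m U _ IH]; first by rewrite cards0.
  by rewrite (leq_trans (leq_card_setU _ _)) // leq_add2l.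
rewrite -cards_draws -sum_nat_const; apply: leq_sum => T.
by rewrite inE => /andP[_ /eqP Tt]; rewrite -Tt card_supersets // Tt.
Qed.

(** * The hidden-set function and its curvature *)

Definition hidden_count (X : finType) (O : {set X}) (a k : nat) (S : {set X}) :=
  maxn (#|S :&: O| - a) (#|S| - k).

Definition hidden_fun (R : realType) (c : R) (X : finType) (O : {set X})
    (a k : nat) (S : {set X}) : R :=
  (1 - c) * #|S|%:R + c * (hidden_count X O a k S)%:R.

Lemma hidden_countU1 (X : finType) (O : {set X}) (a k : nat) (S : {set X}) (j : X) :
  j \notin S ->
  (hidden_count X O a k S <= hidden_count X O a k (j |: S)
    <= (hidden_count X O a k S).+1)%N.
Proof.
move=> jS; rewrite /hidden_count cardsU1 jS setIUl.
have : (#|S :&: O| <= #|[set j] :&: O :|: S :&: O| <= #|S :&: O|.+1)%N.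
  rewrite subset_leq_card ?subsetUr //= -add1n.
  apply: leq_trans (leq_card_setU _ _) _; rewrite leq_add2r -[leqRHS](cards1 j).
  exact: subset_leq_card (subsetIl _ _).
lia.
Qed.

(** Taking [set0] for [O] gives the reference function, which hides nothing. For a small
    intersection the first truncated difference is 0; for [2 * k <= #|S|] the second is at least
    [k], hence dominates. *)
Lemma hidden_count_set0 (X : finType) (O : {set X}) (a k : nat) (S : {set X}) :
  (#|O| <= k)%N -> (#|S :&: O| <= a)%N || (2 * k <= #|S|)%N ->
  hidden_count X O a k S = hidden_count X set0 a k S.
Proof.
move=> Ok; rewrite /hidden_count setI0 cards0.
have := subset_leq_card (subsetIr S O); lia.
Qed.

Lemma marginal_hidden_fun (R : realType) (c : R) (X : finType) (O : {set X})
    (a k : nat) (S : {set X}) (j : X) :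
  j \notin S ->
  marginal (hidden_fun R c X O a k) S j =
  1 - c + c * (hidden_count X O a k (j |: S) - hidden_count X O a k S)%N%:R.
Proof.
move=> jS; have /andP[le_h _] := hidden_countU1 X O a k S j jS.
rewrite /marginal /hidden_fun natrB // cardsU1 jS add1n -natr1; ring.
Qed.

Lemma marginal_hidden_fun_itv (R : realType) (c : R) (X : finType) (O : {set X})
    (a k : nat) (S : {set X}) (j : X) :
  0 <= c -> j \notin S ->
  1 - c <= marginal (hidden_fun R c X O a k) S j <= 1.
Proof.
move=> c0 jS; rewrite marginal_hidden_fun //.
have /andP[_ le_h1] := hidden_countU1 X O a k S j jS.
set d := (_ - _)%N; have d1 : (d <= 1)%N by rewrite /d; lia.
by case: d d1 => [|[|//]] _; lra.
Qed.

Lemma hidden_fun_monotone (R : realType) (c : R) (X : finType) (O : {set X})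
    (a k : nat) :
  0 <= c -> c <= 1 -> monotone (hidden_fun R c X O a k).
Proof.
move=> c0 c1 S T ST; rewrite /hidden_fun; apply: lerD; apply: ler_wpM2l => //.
- by rewrite subr_ge0.
- by rewrite ler_nat subset_leq_card.
rewrite ler_nat /hidden_count; have := subset_leq_card ST.
have := subset_leq_card (setSI O ST); lia.
Qed.

Lemma hidden_fun_curvature (R : realType) (c : R) (X : finType) (O : {set X})
    (a k : nat) :
  0 <= c -> c < 1 -> (0 < a)%N -> (0 < k)%N -> (#|O| <= k)%N ->
  (2 * k < #|X|)%N ->
  curvature (hidden_fun R c X O a k) = c.
Proof.
move=> c0 c1 a0 k0 Ok kX; rewrite /curvature.
set m := \big[_/_]_(_ : X) _; suff -> : m = 1 - c by ring.
apply/eqP; rewrite eq_le; apply/andP; split.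
  have /card_gt0P[j _] : (0 < #|X|)%N by lia.
  have jT : j \notin [set~ j] by rewrite !inE eqxx.
  have j0 : j \notin set0 by rewrite inE.
  have cT : #|[set~ j]| = #|X|.-1 by rewrite cardsC1.
  (* Least marginal: as [a] and [k] are positive, a singleton still has count 0. *)
  have m0 : marginal (hidden_fun R c X O a k) set0 j = 1 - c.
    rewrite marginal_hidden_fun // (_ : (_ - _)%N = 0)%N ?mulr0 ?addr0 //.
    rewrite /hidden_count setU0 set0I cards0 cards1.
    have := subset_leq_card (subsetIl [set j] O); rewrite cards1; lia.
  (* Largest marginal: from [2 * k] elements on, the count is [#|S| - k] and grows with each
     element. *)
  have mT : marginal (hidden_fun R c X O a k) [set~ j] j = 1.
    rewrite marginal_hidden_fun // (_ : (_ - _)%N = 1)%N ?mulr1 ?subrK //.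
    rewrite !hidden_count_set0 //; last first.
    - by rewrite cardsU1 jT cT; lia.
    - by rewrite cT; lia.
    by rewrite /hidden_count !setI0 cards0 cardsU1 jT cT; lia.
  apply: le_trans (bigmin_le _ j _) _.
  apply: le_trans (bigmin_le_cond _ _ (sub0set _)) _.
  apply: le_trans (bigmin_le_cond _ (j := [set~ j]) _ _) _.
    by rewrite subxx mT oner_neq0.
  by rewrite m0 mT divr1.
(* The default value 1 of the three minima must respect the bound too. *)
have le1 : 1 - c <= 1 by rewrite gerBl.
apply: le_bigmin => // j _; apply: le_bigmin => // S SJ; apply: le_bigmin => //.
move=> T /andP[TJ _].
have jS : j \notin S by apply/negP => /(subsetP SJ); rewrite !inE eqxx.
have jT : j \notin T by apply/negP => /(subsetP TJ); rewrite !inE eqxx.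
have /andP[mS _] := marginal_hidden_fun_itv R c X O a k S j c0 jS.
have /andP[mT mT1] := marginal_hidden_fun_itv R c X O a k T j c0 jT.
have c1' : 0 < 1 - c by rewrite subr_gt0.
rewrite ler_pdivlMr ?(lt_le_trans c1') //; nra.
Qed.

Lemma hidden_fun_admissible (R : realType) (c : R) (n : nat) (O : {set 'I_n})
    (a k : nat) :
  0 <= c -> c < 1 -> (0 < a)%N -> (0 < k)%N -> (#|O| <= k)%N -> (2 * k < n)%N ->
  admissible c (hidden_fun R c _ O a k).
Proof.
move=> c0 c1 a0 k0 Ok kn; split.
- by move=> S; rewrite /hidden_fun addr_ge0 // mulr_ge0 // subr_ge0 ltW.
- by apply: hidden_fun_monotone => //; apply: ltW.
- by apply: hidden_fun_curvature => //; rewrite card_ord.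
Qed.

(** Otherwise [Z] is worth at most [(1 - c) * k], whereas comparing [opt] with the value of [O]
    yields the right-hand side of the gap. *)
Lemma approx_solution_meets_hidden (R : realType) (c alpha : R) (X : finType)
    (O Z : {set X}) (a k : nat) :
  0 <= c -> 0 <= alpha -> #|O| = k ->
  (1 - c) * k%:R < alpha * (k%:R - c * a%:R) -> c <= 1 ->
  approx_solution alpha (hidden_fun R c X O a k) k Z ->
  (#|Z| <= k)%N && (a < #|Z :&: O|)%N.
Proof.
move=> c0 alpha0 Ok gap c1 /andP[Zk]; rewrite Zk /= => leZ.
rewrite ltnNge; apply/negP => Za; move: gap; apply/negP; rewrite -leNgt.
apply: le_trans (le_trans leZ _); last first.
  rewrite /hidden_fun hidden_count_set0 ?Ok ?Za // /hidden_count setI0 cards0.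
  rewrite (_ : maxn _ _ = 0)%N; last by lia.
  by rewrite mulr0 addr0 ler_wpM2l ?subr_ge0 ?ler_nat.
apply: ler_wpM2l => //.
apply: le_trans (le_bigmax_cond (j := O) _ _ _); last by rewrite Ok.
rewrite /hidden_fun /hidden_count setIid Ok subnn maxn0.
have : k%:R <= (k - a)%N%:R + a%:R :> R by rewrite -natrD ler_nat; lia.
nra.
Qed.

(** * Detection and success probabilities *)

Lemma card_hidden_detected (X : finType) (S : {set X}) (k t : nat) :
  (t <= k <= #|X|)%N -> (#|S| <= 2 * k)%N ->
  (#|[set O : {set X} | (#|O| == k) && (t <= #|S :&: O|)%N]| * #|X| ^ t <=
    (2 * k * k) ^ t * 'C(#|X|, k))%N.
Proof.
move=> /andP[tk kX] Sk; rewrite expnMn -mulnA.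
apply: leq_trans (leq_mul (card_large_intersection X S k t tk) (leqnn _)) _.
rewrite -mulnA leq_mul ?bin_sub_expn ?tk //.
by apply: leq_trans (bin_leq_expn _ _) _; case: t {tk} => // t; rewrite leq_exp2r.
Qed.

(** Average over all [k]-sets [O]: the mean success probability is at least [p], and a union bound
    over [m] queries and the output bounds it from above. *)
Lemma success_prob_bound (R : realType) (c alpha p : R) (n k a m : nat)
    (A : oracle_alg R 'I_n) :
  0 <= c -> c < 1 -> 0 <= alpha -> (0 < a < k)%N -> (2 * k < n)%N ->
  (1 - c) * k%:R < alpha * (k%:R - c * a%:R) ->
  (forall f, admissible c f -> (num_queries f A <= m)%N) ->
  (forall f, admissible c f -> p <= output_prob f (approx_solution alpha f k) A) ->
  p * (n ^ a.+1)%:R <= ((2 * k * k) ^ a.+1 * m.+1)%:R.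
Proof.
move=> c0 c1 alpha0 /andP[a0 ak] kn gap queries success.
have c1' := ltW c1; have k0 : (0 < k)%N by apply: leq_trans ak.
pose F : {set {set 'I_n}} := [set O : {set 'I_n} | #|O| == k].
pose hits (S : {set 'I_n}) : {set {set 'I_n}} :=
  [set O : {set 'I_n} | (#|O| == k) && (a.+1 <= #|S :&: O|)%N].
(* Larger sets can be left out: as queries their answers do not depend on [O], as outputs they are
   infeasible. *)
pose b := (\max_(S : {set 'I_n} | #|S| <= 2 * k) #|hits S|)%N.
have kF (O : {set 'I_n}) : O \in F -> #|O| = k by rewrite inE => /eqP.
have adm (O : {set 'I_n}) : (#|O| <= k)%N -> admissible c (hidden_fun R c _ O a k).
  by move=> Ok; apply: hidden_fun_admissible.
have cardF : #|F| = 'C(n, k) by rewrite card_draws card_ord.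
have b_le : (b * n ^ a.+1 <= (2 * k * k) ^ a.+1 * 'C(n, k))%N.
  have [|S Sk bE] := eq_bigmax_cond (fun S : {set 'I_n} => #|hits S|)
    (A := [pred S : {set 'I_n} | (#|S| <= 2 * k)%N]).
    by apply/card_gt0P; exists set0; rewrite inE cards0.
  rewrite [b]bE -[n in (n ^ _)%N]card_ord -[n in 'C(n, _)]card_ord.
  by apply: card_hidden_detected; rewrite // card_ord; lia.
have sum_le : p * 'C(n, k)%:R <= (b * m.+1)%:R.
  (* Queries are counted on the reference function, itself admissible, so that [m] bounds them. *)
  apply: le_trans (_ : (b * (num_queries (hidden_fun R c _ set0 a k) A).+1)%:R <= _).
    apply: le_trans (sum_output_prob_le _ _ _
      (fun O => hidden_fun R c _ O a k) _
      (fun O => approx_solution alpha (hidden_fun R c _ O a k) k) _ _ F _ _).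
    - rewrite mulr_natr -cardF -sumr_const; apply: ler_sum => O /kF Ok.
      by apply/success/adm; rewrite Ok.
    - move=> S; have [Sk|Sk] := leqP #|S| (2 * k).
        apply: leq_trans (leq_bigmax_cond _ Sk).
        apply/subset_leq_card/subsetP => O; rewrite !inE => /andP[/eqP Ok].
        rewrite Ok eqxx /= ltnNge; apply: contra => Sa.
        by rewrite /hidden_fun hidden_count_set0 ?Sa ?Ok.
      rewrite (_ : [set _ in _ | _] = set0) ?cards0 //; apply/setP => O.
      rewrite !inE; apply/negP => /andP[/eqP Ok] /negP[].
      by rewrite /hidden_fun hidden_count_set0 ?Ok // (ltnW Sk) orbT.
    - move=> S; case: (boolP (#|S| <= k)%N) => [Sk|Sk].
        have Sk2 : (#|S| <= 2 * k)%N by lia.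
        apply: leq_trans (leq_bigmax_cond _ Sk2).
        apply/subset_leq_card/subsetP => O; rewrite !inE => /andP[/eqP Ok].
        by move=> /(approx_solution_meets_hidden _ _ _ _ _ _ _ _ c0 alpha0 Ok gap c1');
          rewrite Ok eqxx => /andP[].
      rewrite (_ : [set _ in _ | _] = set0) ?cards0 //; apply/setP => O.
      by rewrite !inE /approx_solution (negbTE Sk) andbF.
  rewrite ler_nat leq_mul2l ltnS; apply/orP; right.
  by apply/queries/adm; rewrite cards0.
have N0 : 0 < 'C(n, k)%:R :> R by rewrite ltr0n bin_gt0; lia.
rewrite -(ler_pM2r N0) mulrAC.
apply: le_trans (ler_wpM2r (ler0n _ _) sum_le) _.
by rewrite -!natrM ler_nat mulnAC (mulnAC _ m.+1) leq_mul2r b_le orbT.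
Qed.

(** * Choice of the parameters *)

Lemma horner_nat_bound (q : {poly nat}) :
  exists C : nat, forall n : nat, (0 < n)%N -> (q.[n] < C * n ^ size q)%N.
Proof.
(* The successor makes the bound strict, leaving room for the output, which counts as one more
   query. *)
exists (\sum_(i < size q) q`_i)%R.+1 => n n0; rewrite horner_coef mulSn.
rewrite -add1n leq_add ?expn_gt0 ?n0 //.
elim/big_ind2: _ => [//|x1 y1 x2 y2 le1 le2|i _].
  by rewrite mulnDl leq_add.
rewrite leq_mul2l; apply/orP; right; rewrite -[(_ ^+ _)%R]/(n ^ i)%N.
by rewrite leq_pexp2l // ltnW.
Qed.

(* [n = 2 k^3]: each query detects with probability at most [k^-(3 d + 1)], and
   there are at most [C n^d = C 2^d k^(3 d)] queries. *)
Lemma detection_rate_lt (R : realType) (p : R) (C d k : nat) :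
  0 < p -> (0 < k)%N -> (C * 2 ^ d)%:R / p < k%:R ->
  ((2 * k * k) ^ (3 * d).+1 * (C * (2 * k ^ 3) ^ d))%:R <
    p * ((2 * k ^ 3) ^ (3 * d).+1)%:R.
Proof.
move=> p0 k0; rewrite ltr_pdivrMr // => xk.
(* Cancelling the power of [2 * k * k] leaves [C * 2 ^ d * k ^ (3 * d)] against
   [p * k ^ (3 * d).+1]. *)
rewrite (_ : 2 * k ^ 3 = 2 * k * k * k)%N; last by rewrite !expnS; lia.
set m := (2 * k * k)%N; have m0 : (0 < m)%N by rewrite !muln_gt0 k0.
rewrite [X in _ < p * X%:R](_ : _ = m ^ (3 * d).+1 * k ^ (3 * d).+1)%N; last first.
  by rewrite expnMn.
have mX0 : 0 < (m ^ (3 * d).+1)%:R :> R by rewrite ltr0n expn_gt0 m0.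
rewrite (natrM _ (m ^ _)%N) (natrM _ (m ^ _)%N) [ltRHS]mulrCA (ltr_pM2l mX0).
rewrite (_ : C * (m * k) ^ d = C * 2 ^ d * k ^ (3 * d))%N; last first.
  rewrite (expnM k 3 d) -mulnA -expnMn; congr (_ * _ ^ _)%N.
  by rewrite /m !expnS; lia.
rewrite (expnSr k) (natrM _ _ (k ^ _)%N) (natrM _ _ k).
rewrite [ltRHS](_ : _ = k%:R * p * (k ^ (3 * d))%:R); last by ring.
by rewrite ltr_pM2r ?xk // ltr0n expn_gt0 k0.
Qed.

Theorem theorem16 (R : realType) (c eps : R) :
  0 < c -> c < 1 -> 0 < eps ->
  ~ exists A : alg_family R,
      polynomially_many_queries c A /\
      approximation_algorithm c (1 - c + eps) A.
Proof.
move=> c0 c1 e0 [A [[q queries] [p p0 success]]].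
have [C q_lt] := horner_nat_bound q.
(* The successor keeps [a] positive even if [q] is zero. *)
set d := (size q).+1; set alpha := 1 - c + eps in success.
pose a := (3 * d)%N.
have alpha0 : 0 < alpha by rewrite /alpha addr_gt0 ?subr_gt0.
(* Beyond [x] detection is rare enough; beyond [y] the gap opens, since it amounts to
   [alpha * (c * a) < eps * k]. *)
pose x := (C * 2 ^ d)%:R / p; pose y := alpha * (c * a%:R) / eps.
have x0 : 0 <= x by rewrite divr_ge0 // ltW.
have y0 : 0 <= y.
  by apply: divr_ge0; rewrite ?mulr_ge0 // ltW.
pose k := (Num.bound x + Num.bound y + a.+1)%N; pose n := (2 * k ^ 3)%N.
have xk : x < k%:R.
  by apply: lt_le_trans (archi_boundP x0) _; rewrite ler_nat /k; lia.
have yk : y < k%:R.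
  by apply: lt_le_trans (archi_boundP y0) _; rewrite ler_nat /k; lia.
have ak : (0 < a < k)%N by rewrite /k /a /d; lia.
have k1 : (1 < k)%N by case/andP: ak; lia.
have n0 : (0 < n)%N by rewrite /n muln_gt0 expn_gt0; lia.
have kn : (2 * k < n)%N by rewrite /n; nia.
have gap : (1 - c) * k%:R < alpha * (k%:R - c * a%:R).
  move: yk; rewrite /y ltr_pdivrMr // /alpha; lra.
have := success_prob_bound R c alpha p n k a q.[n] (A n k) (ltW c0) c1
  (ltW alpha0) ak kn gap (queries n k) (success n k).
apply/negP; rewrite -ltNge.
have q_le : (q.[n].+1 <= C * n ^ d)%N.
  apply: leq_trans (q_lt n n0) _.
  by rewrite leq_mul // leq_pexp2l // leqnSn.
apply: le_lt_trans (detection_rate_lt R p C d k p0 (ltnW k1) xk).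
by rewrite ler_nat leq_mul2l q_le orbT.
Qed.
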